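(* Let $q(t)$ be a trajectory of a mechanical system with generalized constraint codistribution $D$ on the Riemannian manifold $(Q,g)$, crossing the singular set of $D$ at time $t_0$ as described in the context, such that the rank $s$ of $D$ at the points $q(t)$, $t\in(t_0,t_0+\epsilon)$, is strictly larger than the rank of $D$ at $q(t_0)$. Let $m$ be the maximum of $s$ and the rank $r$ of $D$ at the points $q(t)$, $t\in(t_0-\epsilon,t_0)$. Then there exist a neighbourhood $W$ of $q(t_0)$ and 1-forms $\omega_1,\dots,\omega_m$ such that $D_q=\mathrm{span}\{\omega_1(q),\dots,\omega_m(q)\}$ for all $q\in W$, which are ordered so that $\omega_1,\dots,\omega_s$ are linearly independent at the posterior points $q(t)$, $t>t_0$ close to $t_0$ (at $q(t_0)$ these $s$ 1-forms are linearly dependent). The post-impact momentum $p(t_0)_+\in T^*_{q(t_0)}Q$ determined from the pre-impact momentum $p(t_0)_-\in T^*_{q(t_0)}Q$ by the jump conditions $$p(t_0)_+-p(t_0)_-\in D^+_{q(t_0)},\qquad p(t_0)_+\in (D^+_{q(t_0)})^{\perp},$$ is given by $$p(t_0)_+=\Big(\lim_{t\to t_0^+}\mathcal{P}_{q(t)}\Big)\,p(t_0)_- .$$ In coordinates, $$p_A(t_0)_+=p_A(t_0)_--\lim_{t\to t_0^+}\Big(\sum_{i,j,B}\mathcal{C}^{ij}\omega_{jB}\,g^{BC}\,\omega_{iA}\Big)\Big|_{q(t)}\,p_C(t_0)_-,\qquad A=1,\dots,n$$ (summation also over the repeated index $C$), or in matrix form $$p(t_0)_+=\Big(\mathrm{Id}-\lim_{t\to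 t_0^+}\big(\omega^{T}\mathcal{C}^{-1}\omega g^{-1}\big)_{|q(t)}\Big)\,p(t_0)_- .$$
   Context: Let $Q$ be an $n$-dimensional differentiable manifold with a Riemannian metric $g$; the system has Lagrangian $L(v)=\frac12 g(v,v)-U(\tau_Q(v))$ on $TQ$, where $\tau_Q:TQ\to Q$ is the projection and $U$ is a function on $Q$ (the potential). The induced inner product on each cotangent space $T^*_qQ$ is also denoted $g$, and $\perp$ is the orthogonal complement in $T^*_qQ$ with respect to it. In local coordinates $(q^A)$ the metric has matrix $(g_{AB})$ with inverse $g^{-1}=(g^{AB})$. A generalized codistribution $D$ on $Q$ is a family of linear subspaces $D_q\subset T^*_qQ$, $q\in Q$. It is differentiable if each point has an open neighbourhood carrying finitely many differentiable 1-forms that span $D_{q'}$ for every $q'$ in that neighbourhood. The rank of $D$ at $q$ is $\rho(q)=\dim D_q$. A point is regular if $\rho$ is constant on a neighbourhood of it, and singular otherwise; $R$ and $S$ denote the sets of regular and singular points. Throughout, $D$ is differentiable and defined on all of $Q$, and the system is constrained by $D$ (velocities are annihilated by $D$, equivalently momenta at $q$ lie in $D_q^\perp$). A trajectory crossing the singular set at time $t_0$ is a motion $q(t)$ with $q(t_0)\in S$, $q((t_0-\epsilon,t_0))\subset R$ and $q((t_0,t_0+\epsilon))\subset R$ for sufficiently small $\epsilon>0$; its momentum may have a finite jump at $t_0$, with pre-impact value $p(t_0)_-$ and post-impact value $p(t_0)_+$, both in $T^*_{q(t_0)}Q$. The ranks of $D$ along $(t_0-\epsilon,t_0)$ and along $(t_0,t_0+\epsilon)$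 are constant. Define $$D^+_{q(t_0)}=\Big\{\alpha\in T^*_{q(t_0)}Q : \exists\,\tilde\alpha:(t_0,t_0+\epsilon)\to T^*Q,\ \tilde\alpha(t)\in D_{q(t)},\ \lim_{t\to t_0^+}\tilde\alpha(t)=\alpha\Big\}.$$ For $q\in Q$, $\mathcal{P}_q:T^*_qQ\to D_q^{\perp}$ denotes the projector onto $D_q^\perp$ associated with the decomposition $T^*_qQ=D_q\oplus D_q^{\perp}$. Write $\omega_i=\omega_{iA}\,dq^A$; $\omega=(\omega_{iA})$ is the $s\times n$ matrix of components of $\omega_1,\dots,\omega_s$, and $\mathcal{C}=\omega g^{-1}\omega^{T}$, i.e. $\mathcal{C}_{ij}=\omega_{iA}g^{AB}\omega_{jB}$ for $1\le i,j\le s$, which is invertible at $q(t)$ for $t>t_0$ close to $t_0$; $\mathcal{C}^{ij}$ are the entries of $\mathcal{C}^{-1}$. At such points $\mathcal{P}_q(\alpha_q)=\alpha_q-\mathcal{C}^{ij}\alpha_q(Z_i)\omega_j$ with $Z_i=g^{AB}\omega_{iB}\,\partial/\partial q^A$. In the matrix formula, momenta are column vectors of components $p_A$.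
   Formalization: Assumed, since both can fail: the limit of the projectors P_{q(t)} as t→t0+ exists, and near q(t0) D is spanned by m 1-forms (if s<r, a fixed choice of s of them is independent at q(t) for t>t0 close to t0). *)

(* Defs.v *)
From HB Require Import structures.
From mathcomp Require Import all_boot all_order all_algebra.
From mathcomp Require Import all_classical all_reals all_analysis.

Set Implicit Arguments.
Unset Strict Implicit.
Unset Printing Implicit Defensive.

Import Order.TTheory GRing.Theory Num.Theory.
Import numFieldNormedType.Exports.

Local Open Scope classical_set_scope.
Local Open Scope ring_scope.

(* "Differentiable" means C^oo throughout.                                    *)

Section Smooth.
Variables (R : realType) (n : nat) (V : normedModType R).

(* f is of class C^k on O, where O is meant to be open *)
Fixpoint Ck (k : nat) (O : set 'rV[R]_n) (f : 'rV[R]_n -> V) : Prop :=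
  if k is k'.+1 then
    (forall x, O x -> differentiable f x) /\
    (forall v : 'rV[R]_n, Ck k' O (fun x => 'd f x v))
  else forall x, O x -> {for x, continuous f}.

Definition smooth_on (O : set 'rV[R]_n) (f : 'rV[R]_n -> V) : Prop :=
  forall k, Ck k O f.

End Smooth.

Record chart (R : realType) (n : nat) (X : topologicalType) := Chart {
  dom : set X ;
  coord : X -> 'rV[R]_n ;
  param : 'rV[R]_n -> X (* the inverse of coord, meaningful on coord @` dom *)
}.

Section Charts.
Variables (R : realType) (n : nat) (X : topologicalType).
Implicit Types c : chart R n X.

Definition is_chart c : Prop :=
  [/\ open (dom c), open (coord c @` dom c),
      (forall p, dom c p -> param c (coord c p) = p),
      (forall p, dom c p -> {for p, continuous (coord c)}) &
      (forall x, (coord c @` dom c) x -> {for x, continuous (param c)})].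

Definition compatible c c' : Prop :=
  smooth_on (coord c @` (dom c `&` dom c')) (coord c' \o param c) /\
  smooth_on (coord c' @` (dom c `&` dom c')) (coord c \o param c').

End Charts.

(* chart_at selects a preferred chart around each point; it only serves to    *)
(* represent tangent vectors and covectors at p by their components in        *)
(* chart_at p.                                                                *)
Record manifold (R : realType) (n : nat) := Manifold {
  point :> topologicalType ;
  atlas : set (chart R n point) ;
  chart_at : point -> chart R n point ;
  manifold_hausdorff : hausdorff_space point ;
  manifold_second_countable : @second_countable point ;
  atlas_chart : forall c, atlas c -> is_chart c ;
  atlas_compatible : forall c c', atlas c -> atlas c' -> compatible c c' ;
  atlas_maximal : forall c, is_chart c ->
    (forall c', atlas c' -> compatible c c') -> atlas c ;
  chart_at_atlas : forall p, atlas (chart_at p) ;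
  chart_at_dom : forall p, dom (chart_at p) p
}.

Section Bundles.
Variables (R : realType) (n : nat) (Q : manifold R n).
Implicit Types (p : Q) (c : chart R n Q).

(* Components along d/dx^A, resp. dx^A, where x = chart_at p. *)
Definition tangent p := 'rV[R]_n.
Definition cotangent p := 'rV[R]_n.

Definition charts_around p : set (chart R n Q) :=
  [set c | atlas c /\ dom c p].

Definition pairing p (alpha : cotangent p) (v : tangent p) : R :=
  (alpha *m v^T) 0 0.

(* Row A is d/dc^A. Jacobians act on row vectors: ('J f x) A B = d_A f^B. *)
Definition frame_mx c p : 'M[R]_n :=
  'J (coord (chart_at p) \o param c) (coord c p).

Definition coframe_mx c p : 'M[R]_n :=
  'J (coord c \o param (chart_at p)) (coord (chart_at p) p).

Definition coord_vec c p (A : 'I_n) : tangent p := row A (frame_mx c p).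

(* dc^A *)
Definition coord_covec c p (A : 'I_n) : cotangent p := (col A (coframe_mx c p))^T.

Definition components c p (alpha : cotangent p) : 'rV[R]_n :=
  \row_A pairing alpha (coord_vec c p A).

(* The matrix M of F in the chart c, acting on columns of components:         *)
(* (F alpha)_A = \sum_C M A C alpha_C.                                        *)
Definition end_mx c p (F : cotangent p -> cotangent p) : 'M[R]_n :=
  \matrix_(A, C) components c (F (coord_covec c p C)) 0 A.

Definition smooth_fun (f : Q -> R) : Prop :=
  forall c, atlas c -> smooth_on (coord c @` dom c) (f \o param c : _ -> R^o).

Definition one_form := forall p, cotangent p.

Definition smooth_one_form_on (W : set Q) (w : one_form) : Prop :=
  forall c, atlas c ->
    smooth_on (coord c @` (dom c `&` W))
      (fun x => components c (w (param c x))).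

(* Limits in T^*Q of covectors along a curve q that is continuous at t0, read *)
(* in the charts around q t0; the resulting notion does not depend on the     *)
(* chart.                                                                     *)
Definition cotangent_cvg (q : R -> Q) (F : set_system R) (t0 : R)
    (alpha : forall t, cotangent (q t)) (alpha0 : cotangent (q t0)) : Prop :=
  forall c, charts_around (q t0) c ->
    (fun t => components c (alpha t)) @ F --> components c alpha0.

(* The same for endomorphisms of the cotangent spaces. *)
Definition cotangent_end_cvg (q : R -> Q) (F : set_system R) (t0 : R)
    (P : forall t, cotangent (q t) -> cotangent (q t))
    (P0 : cotangent (q t0) -> cotangent (q t0)) : Prop :=
  forall c, charts_around (q t0) c ->
    (fun t => end_mx c (P t)) @ F --> end_mx c P0.

End Bundles.

Arguments cotangent_cvg {R n Q} q F t0 alpha alpha0.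
Arguments cotangent_end_cvg {R n Q} q F t0 P P0.

Record riemannian_metric (R : realType) (n : nat) (Q : manifold R n) :=
  RiemannianMetric {
  ip :> forall p : Q, tangent p -> tangent p -> R ;
  ip_linear : forall p a (u v w : tangent p),
    ip (a *: u + v : tangent p) w = a * ip u w + ip v w ;
  ip_sym : forall p (u v : tangent p), ip u v = ip v u ;
  ip_pos : forall p (v : tangent p), v != 0 -> 0 < ip v v ;
  ip_smooth : forall c A B, atlas c ->
    smooth_on (coord c @` dom c)
      (fun x => ip (coord_vec c (param c x) A) (coord_vec c (param c x) B) : R^o)
}.

Section Metric.
Variables (R : realType) (n : nat) (Q : manifold R n).
Variable g : riemannian_metric Q.
Implicit Types (p : Q) (c : chart R n Q).

Definition metric_mx c p : 'M[R]_n :=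
  \matrix_(A, B) g p (coord_vec c p A) (coord_vec c p B).

Definition gram_mx p : 'M[R]_n :=
  \matrix_(A, B) g p (delta_mx 0 A) (delta_mx 0 B).

Definition flat p (v : tangent p) : cotangent p := v *m gram_mx p.
Definition sharp p (alpha : cotangent p) : tangent p := alpha *m invmx (gram_mx p).

Definition cometric p (alpha beta : cotangent p) : R :=
  g p (sharp alpha) (sharp beta).

Definition orth p (E : set (cotangent p)) : set (cotangent p) :=
  [set beta | forall alpha, E alpha -> cometric alpha beta = 0].

(* The projector onto V^perp associated with T^*_p Q = V (+) V^perp. *)
Definition orth_proj p (V : {vspace cotangent p}) (alpha : cotangent p) :
    cotangent p :=
  xget 0 [set beta : cotangent p | orth [set` V] beta /\ alpha - beta \in V].

End Metric.

Section Codistributions.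
Variables (R : realType) (n : nat) (Q : manifold R n).

Definition codistribution := forall p : Q, {vspace cotangent p}.

Variable D : codistribution.

Definition generated_on (W : set Q) (m : nat) (w : 'I_m -> one_form Q) : Prop :=
  [/\ open W, (forall i, smooth_one_form_on W (w i)) &
      forall p, W p -> D p = <<[seq w i p | i : 'I_m]>>%VS].

Definition differentiable_codistribution : Prop :=
  forall p : Q, exists (W : set Q) (m : nat) (w : 'I_m -> one_form Q),
    W p /\ generated_on W w.

Definition rank_at (p : Q) : nat := \dim (D p).

Definition regular_point (p : Q) : Prop :=
  \forall p' \near p, rank_at p' = rank_at p.

Definition singular_point (p : Q) : Prop := ~ regular_point p.

End Codistributions.

Section Dynamics.
Variables (R : realType) (n : nat) (Q : manifold R n).
Variables (g : riemannian_metric Q) (U : Q -> R) (D : codistribution Q).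

Definition lagrangian (p : Q) (v : tangent p) : R := 2^-1 * g p v v - U p.

(* L (q^A, v^A) *)
Definition chart_lagrangian (c : chart R n Q) (x v : 'rV[R]_n) : R^o :=
  lagrangian (v *m frame_mx c (param c x) : tangent (param c x)).

Variable q : R -> Q.

Definition velocity (t : R) : tangent (q t) := derive1 (coord (chart_at (q t)) \o q) t.

Definition momentum (t : R) : cotangent (q t) := flat g (velocity t).

(* d/dt (dL/dv^A) - dL/dq^A *)
Definition euler_lagrange (c : chart R n Q) (t : R) : 'rV[R]_n :=
  let x := coord c \o q in
  \row_A (derive1 (fun t' =>
             'D_(delta_mx 0 A) (chart_lagrangian c (x t')) (derive1 x t')) t
          - 'D_(delta_mx 0 A) (fun y => chart_lagrangian c y (derive1 x t)) (x t)).

(* Lagrange-d'Alembert: the velocity is annihilated by D and the reaction     *)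
(* force takes its values in D.                                               *)
Definition motion_on (I : interval R) : Prop :=
  forall t, t \in I ->
    (forall alpha : cotangent (q t), alpha \in D (q t) ->
       pairing alpha (velocity t) = 0) /\
    (forall c, charts_around (q t) c ->
       [/\ derivable (coord c \o q) t 1,
           derivable (derive1 (coord c \o q)) t 1 &
           exists2 lambda : cotangent (q t), lambda \in D (q t) &
             components c lambda = euler_lagrange c t]).

(* q crosses the singular set at time t0; r and s are the ranks of D before   *)
(* and after t0, and pm is the pre-impact momentum.                           *)
Record crossing (t0 eps : R) (r s : nat) (pm : cotangent (q t0)) : Prop :=
  Crossing {
  crossing_eps : 0 < eps ;
  crossing_continuous : forall t, t \in `]t0 - eps, t0 + eps[ -> {for t, continuous q} ;
  crossing_motion_before : motion_on `]t0 - eps, t0[ ;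
  crossing_motion_after : motion_on `]t0, t0 + eps[ ;
  crossing_singular : singular_point D (q t0) ;
  crossing_regular_before : forall t, t \in `]t0 - eps, t0[ -> regular_point D (q t) ;
  crossing_regular_after : forall t, t \in `]t0, t0 + eps[ -> regular_point D (q t) ;
  crossing_rank_before : forall t, t \in `]t0 - eps, t0[ -> rank_at D (q t) = r ;
  crossing_rank_after : forall t, t \in `]t0, t0 + eps[ -> rank_at D (q t) = s ;
  crossing_pre_momentum : cotangent_cvg q t0^'- t0 momentum pm ;
  crossing_post_momentum :
    exists pp : cotangent (q t0), cotangent_cvg q t0^'+ t0 momentum pp
}.

Variable t0 : R.

(* D^+_{q(t0)} *)
Definition Dplus (eps : R) : set (cotangent (q t0)) :=
  [set alpha | exists alpha_ : forall t, cotangent (q t),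
     (forall t, t \in `]t0, t0 + eps[ -> alpha_ t \in D (q t)) /\
     cotangent_cvg q t0^'+ t0 alpha_ alpha].

Definition jump_conditions (eps : R) (pm pp : cotangent (q t0)) : Prop :=
  Dplus eps (pp - pm) /\ orth g (Dplus eps) pp.

Definition independent_after (s : nat) (w : 'I_s -> one_form Q) : Prop :=
  \forall t \near t0^'+, free [seq w i (q t) | i : 'I_s].

End Dynamics.

Arguments crossing {R n Q} g U D q t0 eps r s pm.
Arguments Dplus {R n Q} D q t0 eps.
Arguments jump_conditions {R n Q} g D q t0 eps pm pp.

Section ConstraintMatrices.
Variables (R : realType) (n : nat) (Q : manifold R n) (g : riemannian_metric Q).
Variables (s : nat) (w : 'I_s -> one_form Q) (c : chart R n Q).

Definition omega_mx (p : Q) : 'M[R]_(s, n) :=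
  \matrix_(i, A) components c (w i p) 0 A.

Definition constraint_mx (p : Q) : 'M[R]_s :=
  omega_mx p *m invmx (metric_mx g c p) *m (omega_mx p)^T.

End ConstraintMatrices.

Definition first_forms (R : realType) (n : nat) (Q : manifold R n) (s r : nat)
    (w : 'I_(maxn s r) -> one_form Q) : 'I_s -> one_form Q :=
  fun i => w (widen_ord (leq_maxl s r) i).

(* Main.v *)
Require Import Defs.
From mathcomp Require Import all_boot all_order all_algebra.
From mathcomp Require Import all_classical all_reals all_analysis.
From HB Require Import structures.
(* Imported a second time so that coord and dom are those of a chart. *)
Import Defs.
Import Order.TTheory GRing.Theory Num.Theory.
Import numFieldNormedType.Exports.
Local Open Scope classical_set_scope.
Local Open Scope ring_scope.

Set Implicit Arguments.
Unset Strict Implicit.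
Unset Printing Implicit Defensive.

(** The projectors onto the orthogonal complements of D along the trajectory turn
    a statement about limits of subspaces into one about a limit of matrices.

    Uniqueness of the post-impact momentum is linear algebra: D^+ is stable under
    differences, so two solutions of the jump conditions differ by a covector which
    lies in D^+ and is orthogonal to D^+, hence vanishes ([jump_unique]).  For
    existence, extend the pre-impact momentum to covectors x_t along the curve, with
    constant components in a chart.  Then P_t x_t - x_t lies in D at time t and
    converges to (lim P) p_- - p_-, so that this difference belongs to D^+; and a
    limit b of covectors b_t of D satisfies <b, (lim P) p_-> = lim <b_t, P_t x_t> = 0
    since the cometric is continuous ([jump_proj]).

    For the coordinate formula, s of the generators are a basis of D just after the
    crossing, where D has dimension s ([independent_span]).  With respect to a basis
    given by the rows of X, the projector is 1 - H X^T (X H X^T)^-1 X on row vectors,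
    H being the matrix of the cometric ([orth_projE]); read in a chart this is
    1 - omega^T C^-1 omega g^-1 acting on columns ([end_orth_proj]), whose limit is
    therefore that of the projectors.

    Covectors are stored by components in a preferred chart which jumps from point
    to point, so every limit is read in a fixed chart.  The chain rule gives the
    change of frames ([transition_comp]), and its continuity makes convergence in one
    chart imply convergence in all ([cotangent_cvg_chart]). *)

(** * Positive definite forms and orthogonal projection of row vectors *)

Section PositiveForms.
Variables (R : realFieldType) (n : nat).
Implicit Types H : 'M[R]_n.

Definition posdef H := forall v : 'rV[R]_n, v != 0 -> 0 < (v *m H *m v^T) 0 0.

Lemma posdef_unit H : posdef H -> H \in unitmx.
Proof.
move=> Hpos; rewrite -row_free_unit -kermx_eq0; apply/eqP/row_matrixP => i.
rewrite row0; apply/eqP/negPn/negP => /Hpos.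
by rewrite -(row_mul i) mulmx_ker row0 mul0mx mxE ltxx.
Qed.

Lemma posdef_eq0 H (v : 'rV[R]_n) : posdef H -> v *m H *m v^T = 0 -> v = 0.
Proof.
by move=> Hpos E; apply/eqP/negPn/negP => /Hpos; rewrite E mxE ltxx.
Qed.

Lemma posdef_inv H : posdef H -> H^T = H -> posdef (invmx H).
Proof.
move=> Hpos Hsym v v0; have Hu := posdef_unit Hpos.
have /Hpos : v *m invmx H != 0.
  by apply: contraNneq v0 => E; rewrite -(mulmxKV Hu v) E mul0mx.
by rewrite mulmxKV// trmx_mul trmx_inv Hsym mulmxA.
Qed.

End PositiveForms.

(** The quadratic form of X H X^T at v is that of H at v X. *)
Lemma posdef_gram (R : realFieldType) (n k : nat) (H : 'M[R]_n) (X : 'M[R]_(k, n)) :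
  posdef H -> row_free X -> posdef (X *m H *m X^T).
Proof.
move=> Hpos Xfree v v0; have /Hpos : v *m X != 0.
  by apply: contraNneq v0 => E; apply/eqP/(row_free_inj Xfree); rewrite E mul0mx.
by rewrite trmx_mul !mulmxA.
Qed.

Section OrthogonalProjection.
Variables (R : realFieldType) (n k : nat).
Implicit Types (H : 'M[R]_n) (X : 'M[R]_(k, n)).

(** The projection, acting on row vectors on the right, onto the H-orthogonal
    complement of the row space of X and parallel to that row space. *)
Definition coproj_mx H X : 'M[R]_n :=
  1%:M - H *m X^T *m invmx (X *m H *m X^T) *m X.

(** If a - b = u X with b orthogonal to the rows of X, then pairing with those rows
    gives a H X^T = u (X H X^T), which determines u. *)
Lemma coproj_mxP H X (a b : 'rV[R]_n) : X *m H *m X^T \in unitmx ->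
  (b *m H *m X^T = 0 /\ exists u, a - b = u *m X) <-> b = a *m coproj_mx H X.
Proof.
move=> Cu; split=> [[bX [u abu]]|->]; last first.
  rewrite mulmxBr mulmx1 subKr; split.
    rewrite !mulmxBl !mulmxA -(mulmxA _ X H) -(mulmxA _ (X *m H) X^T).
    by rewrite mulmxKV// subrr.
  by exists (a *m (H *m X^T *m invmx (X *m H *m X^T))); rewrite -!mulmxA.
have aX : a *m H *m X^T = u *m (X *m H *m X^T).
  by rewrite !mulmxA -abu !mulmxBl bX subr0.
by rewrite mulmxBr mulmx1 !mulmxA aX mulmxK// -abu subKr.
Qed.

End OrthogonalProjection.

Section Rows.
Variables (R : fieldType) (n k : nat) (w : 'I_k -> 'rV[R]_n).

Lemma mem_span_rows (a : 'rV[R]_n) :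
  a \in <<[seq w i | i : 'I_k]>>%VS <-> exists u, a = u *m \matrix_i w i.
Proof.
split=> [/(@coord_span _ _ k [tuple w i | i < k]) ->|[u ->]].
  exists (\row_i vector.coord [tuple w i | i < k] i a).
  rewrite mulmx_sum_row; apply: eq_bigr => i _.
  rewrite mxE rowK; congr (_ *: _).
  by rewrite -tnth_nth (tnth_nth 0) /= (nth_map i) ?nth_ord_enum// size_enum_ord.
rewrite mulmx_sum_row memv_suml// => i _; rewrite memvZ// rowK memv_span//.
exact: codom_f.
Qed.

Lemma free_rows : free [seq w i | i : 'I_k] = row_free (\matrix_i w i).
Proof.
have nthw (i : 'I_k) : [tuple w i | i < k]`_i = w i.
  by rewrite /= (nth_map i) ?nth_ord_enum// size_enum_ord.
apply/(@freeP _ _ k [tuple w i | i < k])/idP => [wfree|wfree c cw0 i].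
  rewrite -kermx_eq0; apply/eqP/row_matrixP => i; rewrite row0.
  apply/rowP => j; rewrite [RHS]mxE.
  apply: (wfree (fun j => row i (kermx (\matrix_i w i)) 0 j)).
  under eq_bigr do rewrite nthw.
  transitivity (row i (kermx (\matrix_i w i)) *m (\matrix_i w i)).
    by rewrite mulmx_sum_row; apply: eq_bigr => l _; rewrite rowK.
  by rewrite -(row_mul i) mulmx_ker row0.
have: \row_i c i = 0.
  apply: (row_free_inj wfree); rewrite mul0mx mulmx_sum_row -[RHS]cw0.
  by apply: eq_bigr => l _; rewrite rowK mxE nthw.
by move/rowP/(_ i); rewrite !mxE.
Qed.

End Rows.

Lemma index_sumE (R : comPzRingType) (s n : nat) (K : 'M[R]_s) (w : 'M[R]_(s, n))
    (M : 'M[R]_n) A C :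
  \sum_(i < s) \sum_(j < s) \sum_(B < n) K i j * w j B * M B C * w i A =
  (w^T *m K *m w *m M) A C.
Proof.
rewrite -!mulmxA mxE; apply: eq_bigr => i _.
rewrite mxE mulrC mxE mulr_suml; apply: eq_bigr => j _.
rewrite mxE mulr_sumr mulr_suml; apply: eq_bigr => B _.
by rewrite !mulrA.
Qed.

(** * Limits of matrices *)

Section MatrixLimits.
Variables (R : realType) (T : Type) (F : set_system T).
Hypothesis FF : Filter F.

Lemma cvg_eq_near (U : topologicalType) (f g : T -> U) (l : U) :
  (\forall t \near F, f t = g t) -> f @ F --> l -> g @ F --> l.
Proof.
move=> fg; apply: cvg_trans; apply: near_eq_cvg.
by apply: filterS fg => t ->.
Qed.

Lemma cvg_mx m n (A : T -> 'M[R]_(m, n)) (M : 'M[R]_(m, n)) :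
  (forall i j, (fun t => A t i j) @ F --> M i j) -> A @ F --> M.
Proof.
move=> AM B [P MP PB].
have: \forall t \near F, forall i j, P i j (A t i j).
  apply: filter_forall => i; apply: filter_forall => j; exact: (AM i j _ (MP i j)).
by apply: filterS => t; exact: PB.
Qed.

Lemma cvg_mxE m n (A : T -> 'M[R]_(m, n)) (M : 'M[R]_(m, n)) i j :
  A @ F --> M -> (fun t => A t i j) @ F --> M i j.
Proof.
move=> AM; apply: (@continuous_cvg _ _ _ F _ A (fun N => N i j) M _ AM).
exact: coord_continuous.
Qed.

Lemma cvg_sum_ring (I : Type) (r : seq I) (P : pred I) (f : I -> T -> R) (l : I -> R) :
  (forall i, f i @ F --> l i) ->
  (fun t => \sum_(i <- r | P i) f i t) @ F --> \sum_(i <- r | P i) l i.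
Proof. by move=> fl; apply: cvg_big => //; exact: add_continuous. Qed.

Lemma cvg_prod_ring (I : Type) (r : seq I) (P : pred I) (f : I -> T -> R) (l : I -> R) :
  (forall i, f i @ F --> l i) ->
  (fun t => \prod_(i <- r | P i) f i t) @ F --> \prod_(i <- r | P i) l i.
Proof. by move=> fl; apply: cvg_big => //; exact: mul_continuous. Qed.

Lemma cvg_mulmx m n p (A : T -> 'M[R]_(m, n)) (B : T -> 'M[R]_(n, p))
    (M : 'M[R]_(m, n)) (N : 'M[R]_(n, p)) :
  A @ F --> M -> B @ F --> N -> (fun t => A t *m B t) @ F --> M *m N.
Proof.
move=> AM BN; apply: cvg_mx => i j; rewrite mxE.
under eq_fun do rewrite mxE.
by apply: cvg_sum_ring => l; apply: cvgM; exact: cvg_mxE.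
Qed.

Lemma cvg_trmx m n (A : T -> 'M[R]_(m, n)) (M : 'M[R]_(m, n)) :
  A @ F --> M -> (fun t => (A t)^T) @ F --> M^T.
Proof.
move=> AM; apply: cvg_mx => i j; rewrite mxE.
by under eq_fun do rewrite mxE; exact: cvg_mxE.
Qed.

Lemma cvg_det n (A : T -> 'M[R]_n) (M : 'M[R]_n) :
  A @ F --> M -> (fun t => \det (A t)) @ F --> \det M.
Proof.
move=> AM; apply: cvg_sum_ring => s; apply: cvgM; first exact: cvg_cst.
by apply: cvg_prod_ring => i; exact: cvg_mxE.
Qed.

(** Near F the matrices A t are invertible, and Cramer's formula expresses their
    inverses by determinants. *)
Lemma cvg_invmx n (A : T -> 'M[R]_n) (M : 'M[R]_n) :
  M \in unitmx -> A @ F --> M -> (fun t => invmx (A t)) @ F --> invmx M.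
Proof.
move=> Mu AM; have dM : \det M != 0 by rewrite -unitfE -unitmxE.
have dA := cvg_det AM.
have adjA : (fun t => (\det (A t))^-1 *: \adj (A t)) @ F --> invmx M.
  rewrite /invmx Mu; apply: cvgZ; first exact: cvgV.
  apply: cvg_mx => i j; rewrite mxE; under eq_fun do rewrite mxE.
  apply: cvgM; first exact: cvg_cst.
  apply: cvg_det; apply: cvg_mx => k l; rewrite !mxE.
  by under eq_fun do rewrite !mxE; exact: cvg_mxE.
apply: cvg_eq_near adjA.
by apply: filterS (cvgr_neq0 _ dA dM) => t dt; rewrite /invmx unitmxE unitfE dt.
Qed.

End MatrixLimits.

Lemma cvg_index_sum (R : realType) (T : Type) (F : set_system T) (s n : nat)
    (K : T -> 'M[R]_s) (w : T -> 'M[R]_(s, n)) (M : T -> 'M[R]_n) (L : 'M[R]_n) A C :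
  Filter F ->
  (w t)^T *m K t *m w t *m M t @[t --> F] --> L ->
  \sum_(i < s) \sum_(j < s) \sum_(B < n) K t i j * w t j B * M t B C * w t i A
    @[t --> F] --> L A C.
Proof.
move=> FF wKwM; under eq_fun do rewrite index_sumE.
exact: cvg_mxE wKwM.
Qed.

Lemma sub_mulmx_entry (R : pzRingType) (n : nat) (x y : 'rV[R]_n) (N : 'M[R]_n) :
  y^T = (1%:M - N) *m x^T -> forall A, y 0 A = x 0 A - \sum_K N A K * x 0 K.
Proof.
move=> yT A; have <- : y^T A 0 = y 0 A by rewrite mxE.
rewrite yT mulmxBl mul1mx [LHS]mxE [X in X + _]mxE; congr (_ + _).
by rewrite [LHS]mxE mxE; congr (- _); apply: eq_bigr => K _; rewrite mxE.
Qed.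

(** * Jacobians *)

Section Jacobians.
Variables (K : numFieldType) (n : nat).
Implicit Types (f g h : 'rV[K]_n -> 'rV[K]_n) (x : 'rV[K]_n).

Lemma mul_jacobian f x v : v *m 'J f x = 'd f x v.
Proof. exact: mul_rV_lin1. Qed.

Lemma jacobian_entry f x i j : 'J f x i j = 'd f x (delta_mx 0 i) 0 j.
Proof. by rewrite /jacobian /lin1_mx mxE. Qed.

Lemma mulmx_inj (A B : 'M[K]_n) :
  (forall v : 'rV_n, v *m A = v *m B) -> A = B.
Proof. by move=> AB; apply/row_matrixP => i; rewrite !rowE; exact: AB. Qed.

(** The Jacobian is local; directional derivatives carry this over to the
    differential. *)
Lemma jacobian_near f h x :
  differentiable f x -> differentiable h x -> (\near x, h x = f x) ->
  'J h x = 'J f x.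
Proof.
move=> df dh hf; apply: mulmx_inj => v.
apply: etrans (mul_jacobian h x v) _; apply: etrans _ (esym (mul_jacobian f x v)).
apply: etrans (esym (deriveE v dh)) _; apply: etrans _ (deriveE v df).
exact: near_eq_derive.
Qed.

Lemma jacobian_id x : 'J id x = 1%:M.
Proof.
by apply: mulmx_inj => v; rewrite mul_jacobian mulmx1 -deriveE ?derive_id.
Qed.

Lemma jacobian_comp f g x :
  differentiable f x -> differentiable g (f x) ->
  'J (g \o f) x = 'J f x *m 'J g (f x).
Proof.
move=> df dg; apply: mulmx_inj => v.
rewrite [LHS]mul_jacobian diff_comp//=.
by rewrite mulmxA [X in X *m _]mul_jacobian [RHS]mul_jacobian.
Qed.

End Jacobians.

(** * Frames, coframes and components *)

(** The Jacobian of the change of coordinates from c to c' at p.  It is locked so that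
    comparing two of them by unification never unfolds the underlying differential,
    which is defined by choice. *)
HB.lock Definition transition_mx (R : realType) (n : nat) (Q : manifold R n)
    (c c' : chart R n Q) (p : Q) : 'M[R]_n :=
  'J (coord c' \o param c) (coord c p).

Section Frames.
Variables (R : realType) (n : nat) (Q : manifold R n).
Implicit Types (p : Q) (c : chart R n Q).

(** The image of the chart is open and param c is continuous on it, so param c stays
    in A near coord c p. *)
Lemma chart_nbhs c p (A : set Q) : atlas c -> dom c p -> nbhs p A ->
  nbhs (coord c p) (coord c @` (dom c `&` A)).
Proof.
move=> /atlas_chart[_ oc pK _ pc] cp Ap.
have xp : (coord c @` dom c) (coord c p) by exists p.
have pA : nbhs (coord c p) (param c @^-1` A) by apply: (pc _ xp); rewrite pK.
have xd : nbhs (coord c p) (coord c @` dom c) by exact: open_nbhs_nbhs.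
apply: filterS2 xd pA => _ [z cz <-] /=; rewrite /= pK// => Az.
by exists z.
Qed.

Lemma nbhs_dom c p : atlas c -> dom c p -> nbhs p (dom c).
Proof. by move=> /atlas_chart[oc _ _ _ _] cp; exact: open_nbhs_nbhs. Qed.

Lemma transition_diff c c' p : atlas c -> atlas c' -> dom c p -> dom c' p ->
  differentiable (coord c' \o param c) (coord c p).
Proof.
move=> ac ac' cp c'p; have [/(_ 1%N)[+ _] _] := atlas_compatible ac ac'.
by apply; exists p.
Qed.

Lemma transition_id c p : atlas c -> dom c p -> transition_mx c c p = 1%:M.
Proof.
move=> ac cp; rewrite transition_mx.unlock; apply: etrans (jacobian_id _).
apply: jacobian_near => //.
  exact: transition_diff.
apply: filterS (chart_nbhs ac cp (filterT : nbhs p setT)) => _ [z [cz _] <-].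
by have [_ _ pK _ _] := atlas_chart ac; rewrite /= pK.
Qed.

Lemma transition_comp c c' c'' p : atlas c -> atlas c' -> atlas c'' ->
  dom c p -> dom c' p -> dom c'' p ->
  transition_mx c c'' p = transition_mx c c' p *m transition_mx c' c'' p.
Proof.
move=> ac ac' ac'' cp c'p c''p.
have [_ _ pK _ _] := atlas_chart ac; have [_ _ pK' _ _] := atlas_chart ac'.
have xp : (coord c' \o param c) (coord c p) = coord c' p by rewrite /= pK.
have df := transition_diff ac ac' cp c'p.
have dg : differentiable (coord c'' \o param c') ((coord c' \o param c) (coord c p)).
  by rewrite xp; exact: transition_diff.
rewrite transition_mx.unlock -[in RHS]xp; apply: etrans (jacobian_comp df dg).
apply: jacobian_near.
- exact: differentiable_comp.
- exact: transition_diff.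
apply: filterS (chart_nbhs ac cp (nbhs_dom ac' c'p)) => _ [z [cz c'z] <-].
by rewrite /= pK// pK'.
Qed.

Lemma frame_mxE c p : frame_mx c p = transition_mx c (chart_at p) p.
Proof. by rewrite transition_mx.unlock. Qed.

Lemma coframe_mxE c p : coframe_mx c p = transition_mx (chart_at p) c p.
Proof. by rewrite transition_mx.unlock. Qed.

Lemma frame_transition c c' p : atlas c -> atlas c' -> dom c p -> dom c' p ->
  frame_mx c' p = transition_mx c' c p *m frame_mx c p.
Proof.
move=> ac ac' cp c'p; rewrite (frame_mxE c') (frame_mxE c).
apply: transition_comp => //.
- exact: chart_at_atlas.
- exact: chart_at_dom.
Qed.

Lemma mul_frame_coframe c p : atlas c -> dom c p ->
  frame_mx c p *m coframe_mx c p = 1%:M.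
Proof.
move=> ac cp; rewrite frame_mxE coframe_mxE -(transition_id ac cp).
apply/esym/transition_comp => //.
- exact: chart_at_atlas.
- exact: chart_at_dom.
Qed.

Lemma frame_unit c p : atlas c -> dom c p -> frame_mx c p \in unitmx.
Proof. by move=> ac cp; exact: (mulmx1_unit (mul_frame_coframe ac cp)).1. Qed.

Lemma mul_coframe_frame c p : atlas c -> dom c p ->
  coframe_mx c p *m frame_mx c p = 1%:M.
Proof. by move=> ac cp; exact/mulmx1C/mul_frame_coframe. Qed.

Lemma componentsE c p (a : cotangent p) : components c a = a *m (frame_mx c p)^T.
Proof.
apply/rowP => A; rewrite mxE /pairing /coord_vec; move: (frame_mx c p) => M.
by rewrite !mxE; apply: eq_bigr => B _; rewrite !mxE.
Qed.

(** Inverse of components: the covector at p with prescribed components in c. *)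
Definition covec_of c p (x : 'rV[R]_n) : cotangent p := x *m (coframe_mx c p)^T.

Lemma covec_ofK c p x : atlas c -> dom c p -> components c (covec_of c p x) = x.
Proof.
move=> ac cp; rewrite componentsE /covec_of.
have := mul_frame_coframe ac cp; move: (coframe_mx c p) (frame_mx c p) => G E EG.
by rewrite -mulmxA -trmx_mul EG trmx1 mulmx1.
Qed.

Lemma coord_covecE c p (A : 'I_n) : coord_covec c p A = covec_of c p (delta_mx 0 A).
Proof. by rewrite /coord_covec /covec_of -rowE tr_col. Qed.

(** end_mx acts on columns whereas M acts on rows, hence the transposes; the outer
    factors are inverse to each other by [mul_frame_coframe]. *)
Lemma end_mxE c p (f : cotangent p -> cotangent p) (M : 'M[R]_n) :
  (forall a, f a = a *m M) ->
  (end_mx c f)^T = (coframe_mx c p)^T *m M *m (frame_mx c p)^T.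
Proof.
move=> fM; apply/matrixP => C A; rewrite mxE /end_mx mxE fM componentsE.
by rewrite coord_covecE /covec_of -!mulmxA -rowE mxE.
Qed.

Lemma components_end c p (f : cotangent p -> cotangent p) (M : 'M[R]_n) a :
  atlas c -> dom c p -> (forall a, f a = a *m M) ->
  components c (f a) = components c a *m (end_mx c f)^T.
Proof.
move=> ac cp fM; rewrite (end_mxE c fM) 2!componentsE fM.
have := mul_coframe_frame ac cp; move: (coframe_mx c p) (frame_mx c p) => G E GE.
by rewrite !mulmxA -[in RHS](mulmxA a) -trmx_mul GE trmx1 mulmx1.
Qed.

Section Limits.
Variables (q : R -> Q) (t0 : R) (F : set_system R).
Hypotheses (FF : Filter F) (qF : q @ F --> q t0).

Lemma near_dom c : charts_around (q t0) c -> \forall t \near F, dom c (q t).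
Proof. by move=> [ac cp]; exact: (qF (nbhs_dom ac cp)). Qed.

Lemma cvg_coord c : charts_around (q t0) c ->
  (fun t => coord c (q t)) @ F --> coord c (q t0).
Proof.
move=> [ac cp]; have [_ _ _ cc _] := atlas_chart ac.
apply: (@continuous_cvg _ _ _ F _ q (coord c) (q t0) _ qF).
exact: cc.
Qed.

Lemma cvg_chart_fun (V : topologicalType) (k : Q -> V) c :
  charts_around (q t0) c -> {for coord c (q t0), continuous (k \o param c)} ->
  (fun t => k (q t)) @ F --> k (q t0).
Proof.
move=> hc kc; have [ac cp] := hc; have [_ _ pK _ _] := atlas_chart ac.
have kE p : dom c p -> (k \o param c) (coord c p) = k p by move=> dp; rewrite /= pK.
rewrite -(kE _ cp).
apply: (@cvg_eq_near _ _ FF _ (fun t => (k \o param c) (coord c (q t)))).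
  by apply: filterS (near_dom hc) => t; exact: kE.
exact: (@continuous_cvg _ _ _ F _ (fun t => coord c (q t)) (k \o param c) _ kc
  (cvg_coord hc)).
Qed.

Lemma cvg_transition c c' : charts_around (q t0) c -> charts_around (q t0) c' ->
  (fun t => transition_mx c c' (q t)) @ F --> transition_mx c c' (q t0).
Proof.
move=> hc hc'; have [ac cp] := hc; have [ac' c'p] := hc'.
have [/(_ 1%N)[_ +] _] := atlas_compatible ac ac'.
move=> ck; rewrite transition_mx.unlock; apply: cvg_mx => i j.
pose h x : 'rV[R]_n := 'd (coord c' \o param c) x (delta_mx 0 i).
have hc0 : (fun t => h (coord c (q t))) @ F --> h (coord c (q t0)).
  apply: (@continuous_cvg _ _ _ F _ (fun t => coord c (q t)) h _ _ (cvg_coord hc)).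
  by apply: ck; exists (q t0).
pose J x := 'J (coord c' \o param c) x i j.
have Jh : J = (fun x => h x 0 j) by apply/funext => x; exact: jacobian_entry.
have : (fun t => J (coord c (q t))) @ F --> J (coord c (q t0)).
  by rewrite Jh; exact: cvg_mxE hc0.
exact.
Qed.

(** Components in c' are those in c times the transposed Jacobian of the change of
    coordinates, which is continuous along the curve. *)
Lemma cotangent_cvg_chart c (a : forall t, cotangent (q t)) (a0 : cotangent (q t0)) :
  charts_around (q t0) c ->
  (fun t => components c (a t)) @ F --> components c a0 ->
  cotangent_cvg q F t0 a a0.
Proof.
move=> hc aa c' hc'; have [ac cp] := hc; have [ac' c'p] := hc'.
rewrite componentsE (frame_transition ac ac')// trmx_mul mulmxA -componentsE.
apply: (cvg_eq_near FF _ (cvg_mulmx FF aa (cvg_trmx FF (cvg_transition hc' hc)))).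
near=> t; have ct : dom c (q t) by near: t; exact: near_dom.
have c't : dom c' (q t) by near: t; exact: near_dom.
by rewrite [RHS]componentsE (frame_transition ac ac')// trmx_mul mulmxA -componentsE.
Unshelve. all: by end_near. Qed.

End Limits.

End Frames.

(** * The metric and the cometric *)

(** The inverse of a form transforms contravariantly under a change of basis E. *)
Lemma congruence_inv (R : fieldType) (n : nat) (E G : 'M[R]_n) :
  E \in unitmx -> G \in unitmx -> E^T *m invmx (E *m G *m E^T) *m E = invmx G.
Proof.
move=> Eu Gu; have Mu : E *m G *m E^T \in unitmx by rewrite !unitmx_mul Eu Gu unitmx_tr.
set S := _ *m E; have ES : E *m (G *m S) = E by rewrite !mulmxA mulmxV// mul1mx.
have GS : G *m S = 1%:M by rewrite -[LHS](mulKmx Eu) ES mulVmx.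
by rewrite -[LHS](mulKmx Gu) GS mulmx1.
Qed.

Section Metric.
Variables (R : realType) (n : nat) (Q : manifold R n) (g : riemannian_metric Q).
Implicit Types (p : Q) (c : chart R n Q).

Lemma linear_sum_delta (f : 'rV[R]_n -> R) u :
  (forall a u v, f (a *: u + v) = a * f u + f v) ->
  f u = \sum_A u 0 A * f (delta_mx 0 A).
Proof.
move=> fl; have f0 : f 0 = 0.
  by have := fl (-1) 0 0; rewrite scaler0 addr0 mulN1r addNr.
have fD v w : f (v + w) = f v + f w by have := fl 1 v w; rewrite scale1r mul1r.
rewrite [in LHS](row_sum_delta u) (big_morph f fD f0); apply: eq_bigr => A _.
by rewrite -[_ *: _]addr0 fl f0 addr0.
Qed.

Lemma ip_gram p (u v : tangent p) : g p u v = (u *m gram_mx g p *m v^T) 0 0.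
Proof.
rewrite (@linear_sum_delta (fun u : 'rV_n => g p u v)); last first.
  by move=> a x y; exact: ip_linear.
rewrite -mulmxA mxE; apply: eq_bigr => A _; congr (_ * _).
rewrite ip_sym (@linear_sum_delta (fun v : 'rV_n => g p v _)); last first.
  by move=> a x y; exact: ip_linear.
rewrite mxE; apply: eq_bigr => B _.
by rewrite !mxE mulrC ip_sym.
Qed.

Lemma gram_sym p : (gram_mx g p)^T = gram_mx g p.
Proof. by apply/matrixP => A B; rewrite !mxE ip_sym. Qed.

Lemma gram_posdef p : posdef (gram_mx g p).
Proof. by move=> v v0; rewrite -ip_gram; exact: ip_pos. Qed.

Lemma cogram_posdef p : posdef (invmx (gram_mx g p)).
Proof. by apply: posdef_inv; [exact: gram_posdef|exact: gram_sym]. Qed.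

Lemma cometricE p (a b : cotangent p) :
  cometric g a b = (a *m invmx (gram_mx g p) *m b^T) 0 0.
Proof.
rewrite /cometric ip_gram /sharp (mulmxKV (posdef_unit (@gram_posdef p))).
by rewrite trmx_mul trmx_inv gram_sym !mulmxA.
Qed.

Lemma metric_mxE c p :
  metric_mx g c p = frame_mx c p *m gram_mx g p *m (frame_mx c p)^T.
Proof.
apply/matrixP => A B; rewrite mxE ip_gram /coord_vec.
move: (frame_mx c p) (gram_mx g p) => E G.
by rewrite -row_mul [LHS]mxE [RHS]mxE; apply: eq_bigr => j _; rewrite !mxE.
Qed.

Lemma metric_posdef c p : atlas c -> dom c p -> posdef (metric_mx g c p).
Proof.
move=> ac cp; rewrite metric_mxE; apply: posdef_gram; first exact: gram_posdef.
by rewrite row_free_unit; exact: frame_unit.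
Qed.

Lemma metric_inv c p : atlas c -> dom c p ->
  (frame_mx c p)^T *m invmx (metric_mx g c p) *m frame_mx c p = invmx (gram_mx g p).
Proof.
move=> ac cp; rewrite metric_mxE; apply: congruence_inv; first exact: frame_unit.
exact/posdef_unit/gram_posdef.
Qed.

Lemma cometric_components c p (a b : cotangent p) : atlas c -> dom c p ->
  cometric g a b =
  (components c a *m invmx (metric_mx g c p) *m (components c b)^T) 0 0.
Proof.
move=> ac cp; rewrite cometricE 2!componentsE -(metric_inv ac cp).
by move: (frame_mx c p) => E; rewrite trmx_mul trmxK !mulmxA.
Qed.

Lemma cvg_metric (q : R -> Q) (t0 : R) (F : set_system R) c :
  Filter F -> q @ F --> q t0 -> charts_around (q t0) c ->
  (fun t => metric_mx g c (q t)) @ F --> metric_mx g c (q t0).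
Proof.
move=> FF qF hc; have [ac cp] := hc; apply: cvg_mx => A B.
have [k kE] : exists k : Q -> R^o, k = fun p => g p (coord_vec c p A) (coord_vec c p B).
  by eexists.
have ksm : smooth_on (coord c @` dom c) (k \o param c).
  rewrite kE; exact: ip_smooth.
have kcont := ksm 0%N _ (imageP (coord c) cp).
have := cvg_chart_fun FF qF hc kcont.
have -> : k = fun p => metric_mx g c p A B by apply/funext => p; rewrite kE mxE.
exact.
Qed.

Lemma cvg_cometric (q : R -> Q) (t0 : R) (F : set_system R)
    (a b : forall t, cotangent (q t)) (a0 b0 : cotangent (q t0)) :
  Filter F -> q @ F --> q t0 ->
  cotangent_cvg q F t0 a a0 -> cotangent_cvg q F t0 b b0 ->
  (fun t => cometric g (a t) (b t)) @ F --> cometric g a0 b0.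
Proof.
move=> FF qF aa bb; pose c := chart_at (q t0).
have hc : charts_around (q t0) c by split; [exact: chart_at_atlas|exact: chart_at_dom].
have [ac cp] := hc; rewrite (cometric_components a0 b0 ac cp).
pose f t := components c (a t) *m invmx (metric_mx g c (q t)) *m (components c (b t))^T.
apply: (@cvg_eq_near _ _ FF _ (fun t => f t 0 0)).
  by apply: filterS (near_dom qF hc) => t ct; exact/esym/(cometric_components _ _ ac ct).
apply: (cvg_mxE FF); apply: (cvg_mulmx FF _ (cvg_trmx FF (bb c hc))).
apply: (cvg_mulmx FF (aa c hc)); apply: (cvg_invmx FF _ (cvg_metric FF qF hc)).
exact: posdef_unit (metric_posdef ac cp).
Qed.

End Metric.

(** * The orthogonal projector *)

Section Projector.
Variables (R : realType) (n : nat) (Q : manifold R n) (g : riemannian_metric Q).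
Implicit Types (p : Q) (c : chart R n Q).

Lemma cometric_sym p (a b : cotangent p) : cometric g a b = cometric g b a.
Proof. exact: ip_sym. Qed.

Lemma orth_span p k (w : 'I_k -> cotangent p) (V : {vspace cotangent p}) b :
  V = <<[seq w i | i : 'I_k]>>%VS ->
  @orth R n Q g p [set` V] b <-> b *m invmx (gram_mx g p) *m (\matrix_i w i)^T = 0.
Proof.
move=> VE; split=> [Vb|b0 a /=].
  apply/rowP => i; rewrite [RHS]mxE.
  have : w i \in V by rewrite VE memv_span// codom_f.
  move=> /Vb; rewrite cometric_sym cometricE => <-.
  by rewrite mxE [RHS]mxE; apply: eq_bigr => j _; rewrite !mxE.
rewrite VE => /mem_span_rows[u ->].
by rewrite cometric_sym cometricE trmx_mul mulmxA b0 mul0mx mxE.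
Qed.

Lemma orth_decompP p k (w : 'I_k -> cotangent p) (V : {vspace cotangent p}) a b :
  free [seq w i | i : 'I_k] -> V = <<[seq w i | i : 'I_k]>>%VS ->
  @orth R n Q g p [set` V] b /\ a - b \in V <->
  b = a *m coproj_mx (invmx (gram_mx g p)) (\matrix_i w i).
Proof.
rewrite free_rows => wfree VE.
have Cu := posdef_unit (posdef_gram (@cogram_posdef R n Q g p) wfree).
split=> [[/(orth_span _ VE) bX]|/(coproj_mxP _ _ Cu)[bX abX]].
  by rewrite VE => /mem_span_rows abX; exact/coproj_mxP.
by split; [exact/(orth_span _ VE)|rewrite VE; exact/mem_span_rows].
Qed.

Lemma orth_projE p k (w : 'I_k -> cotangent p) (V : {vspace cotangent p}) a :
  free [seq w i | i : 'I_k] -> V = <<[seq w i | i : 'I_k]>>%VS ->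
  orth_proj g V a = a *m coproj_mx (invmx (gram_mx g p)) (\matrix_i w i).
Proof.
move=> wfree VE; have VP b := orth_decompP a b wfree VE.
by apply: xget_subset1 => [|b b' /VP -> /VP ->//]; exact/VP.
Qed.

Lemma vspace_family p (V : {vspace cotangent p}) :
  exists k (w : 'I_k -> cotangent p),
    free [seq w i | i : 'I_k] /\ V = <<[seq w i | i : 'I_k]>>%VS.
Proof.
exists (\dim V), (tnth (vbasis V)).
have -> : [seq tnth (vbasis V) i | i : 'I_(\dim V)] = vbasis V :> seq _.
  exact: map_tnth_enum.
by rewrite (basis_free (vbasisP V)) (span_basis (vbasisP V)).
Qed.

Lemma orth_proj_linear p (V : {vspace cotangent p}) :
  exists M : 'M[R]_n, forall a, orth_proj g V a = a *m M.
Proof.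
have [k [w [wfree VE]]] := @vspace_family p V.
exists (coproj_mx (invmx (gram_mx g p)) (\matrix_i w i)) => a.
exact: orth_projE.
Qed.

Lemma orth_projP p (V : {vspace cotangent p}) a :
  @orth R n Q g p [set` V] (orth_proj g V a) /\ a - orth_proj g V a \in V.
Proof.
have [k [w [wfree VE]]] := @vspace_family p V.
exact/(orth_decompP a _ wfree VE)/orth_projE.
Qed.

Lemma cometric_eq0 p (a : cotangent p) : cometric g a a = 0 -> a = 0.
Proof.
rewrite cometricE => a0; apply: (posdef_eq0 (@cogram_posdef R n Q g p)).
by apply/matrixP => i j; rewrite !ord1 a0 mxE.
Qed.

Lemma cometricBr p (a b b' : cotangent p) :
  cometric g a (b - b') = cometric g a b - cometric g a b'.
Proof. by rewrite !cometricE linearB /= mulmxBr !mxE. Qed.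

End Projector.

(** * The jump conditions *)

Section Jump.
Variables (R : realType) (n : nat) (Q : manifold R n) (g : riemannian_metric Q).
Variables (D : codistribution Q) (q : R -> Q) (t0 eps : R).
Hypothesis eps_gt0 : 0 < eps.
Hypothesis qt0 : q @ t0^'+ --> q t0.

Lemma componentsB c p (a b : cotangent p) :
  @components R n Q c p (a - b) = components c a - components c b.
Proof.
have E := @componentsE R n Q c p.
by rewrite (E (a - b)) (E a) (E b); exact: mulmxBl.
Qed.

Lemma cotangent_cvgB (F : set_system R) (a b : forall t, cotangent (q t)) a0 b0 :
  Filter F -> cotangent_cvg q F t0 a a0 -> cotangent_cvg q F t0 b b0 ->
  cotangent_cvg q F t0 (fun t => a t - b t) (a0 - b0).
Proof.
move=> FF aa bb c hc; rewrite componentsB; under eq_fun do rewrite componentsB.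
by apply: cvgB; [exact: aa|exact: bb].
Qed.

Lemma DplusB a b : Dplus D q t0 eps a -> Dplus D q t0 eps b ->
  Dplus D q t0 eps (a - b).
Proof.
move=> [a_ [aD aa]] [b_ [bD bb]]; exists (fun t => a_ t - b_ t); split.
  by move=> t tI; rewrite memvB ?aD ?bD.
exact: cotangent_cvgB.
Qed.

(** The difference of two solutions is in D^+ and orthogonal to D^+. *)
Lemma jump_unique pm pp pp' :
  jump_conditions g D q t0 eps pm pp -> jump_conditions g D q t0 eps pm pp' ->
  pp = pp'.
Proof.
move=> [ppD ppo] [pp'D pp'o]; apply/eqP; rewrite -subr_eq0; apply/eqP.
have dD : Dplus D q t0 eps (pp - pp').
  by have := DplusB ppD pp'D; rewrite opprB addrA subrK.
have := cometricBr g (pp - pp' : cotangent (q t0)) pp pp'.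
by rewrite (ppo _ dD) (pp'o _ dD) subrr => /cometric_eq0.
Qed.

(** A covector at q t0 is carried to q t by keeping its components in the chart
    preferred at q t0.  This is meaningful only while q t stays in the domain of that
    chart, which is enough for limits at t0. *)
Definition constant_ext (a : cotangent (q t0)) t : cotangent (q t) :=
  covec_of (chart_at (q t0)) (q t) (components (chart_at (q t0)) a).

Lemma chart_at_around : charts_around (q t0) (chart_at (q t0)).
Proof. by split; [exact: chart_at_atlas|exact: chart_at_dom]. Qed.

Lemma constant_extE a : \forall t \near t0^'+,
  components (chart_at (q t0)) (constant_ext a t) = components (chart_at (q t0)) a.
Proof.
apply: filterS (near_dom qt0 chart_at_around) => t ct.
by apply: covec_ofK => //; exact: chart_at_atlas.
Qed.

Lemma cvg_constant_ext a : cotangent_cvg q t0^'+ t0 (constant_ext a) a.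
Proof.
apply: (cotangent_cvg_chart _ qt0 chart_at_around).
exact: (cvg_near_cst _ (constant_extE a)).
Qed.

(** In the chart the extension is constant, so only the matrices of P vary, and these
    converge. *)
Lemma cvg_apply (P : forall t, cotangent (q t) -> cotangent (q t))
    (P0 : cotangent (q t0) -> cotangent (q t0)) a :
  (forall t, exists M : 'M[R]_n, forall b, P t b = b *m M) ->
  (exists M : 'M[R]_n, forall b, P0 b = b *m M) ->
  cotangent_end_cvg q t0^'+ t0 P P0 ->
  cotangent_cvg q t0^'+ t0 (fun t => P t (constant_ext a t)) (P0 a).
Proof.
move=> Plin [M0 P0M] PP; pose c := chart_at (q t0).
apply: (cotangent_cvg_chart _ qt0 chart_at_around).
have [ac cp] := chart_at_around.
rewrite (components_end a ac cp P0M).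
have PPc := PP c chart_at_around.
apply: (cvg_eq_near _ _ (cvg_mulmx _ (cvg_cst (components c a)) (cvg_trmx _ PPc))).
apply: filterS2 (near_dom qt0 chart_at_around) (constant_extE a) => t ct ext.
have [M PM] := Plin t.
by rewrite (components_end _ ac ct PM) ext.
Qed.

Lemma near_after : \forall t \near t0^'+, t \in `]t0, t0 + eps[.
Proof.
near=> t; rewrite in_itv /=; apply/andP; split; near: t.
  exact: nbhs_right_gt.
by apply: nbhs_right_lt; rewrite ltrDl.
Unshelve. all: by end_near. Qed.

(** The extension x of pm gives the curve P x - x in D, which witnesses the first jump
    condition; P x stays orthogonal to every curve in D, and the cometric is
    continuous, which gives the second. *)
Lemma jump_proj (P : {linear cotangent (q t0) -> cotangent (q t0)}) pm :
  cotangent_end_cvg q t0^'+ t0 (fun t => orth_proj g (D (q t))) P ->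
  jump_conditions g D q t0 eps pm (P pm).
Proof.
move=> hP.
have Plin : exists M : 'M[R]_n, forall b, P b = b *m M.
  by exists (lin1_mx P) => b; rewrite mul_rV_lin1.
have Pcvg := cvg_apply (a := pm) (fun t => orth_proj_linear g (D (q t))) Plin hP.
split.
  exists (fun t => orth_proj g (D (q t)) (constant_ext pm t) - constant_ext pm t).
  split=> [t _|]; last exact: (cotangent_cvgB _ Pcvg (@cvg_constant_ext pm)).
  by rewrite -opprB memvN (orth_projP g (D (q t)) _).2.
move=> b [b_ [bD bb]]; have lP := cvg_cometric (g := g) _ qt0 bb Pcvg.
apply: (cvg_unique (@norm_hausdorff R R^o) (lP _) _).
apply: cvg_near_cst; apply: filterS near_after => t /bD.
exact: (orth_projP g (D (q t)) _).1.
Qed.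

Lemma jump_iff (P : {linear cotangent (q t0) -> cotangent (q t0)}) pm pp :
  cotangent_end_cvg q t0^'+ t0 (fun t => orth_proj g (D (q t))) P ->
  jump_conditions g D q t0 eps pm pp <-> pp = P pm.
Proof.
move=> hP; split=> [ppj|->]; last exact: jump_proj.
exact: jump_unique ppj (jump_proj pm hP).
Qed.

End Jump.

(** * The projector in coordinates *)

Section Coordinates.
Variables (R : realType) (n : nat) (Q : manifold R n) (g : riemannian_metric Q).
Variables (s : nat) (v : 'I_s -> one_form Q).
Implicit Types (p : Q) (c : chart R n Q).

Lemma omega_mxE c p : omega_mx v c p = (\matrix_i v i p) *m (frame_mx c p)^T.
Proof.
apply/row_matrixP => i; rewrite row_mul 2!rowK; exact: componentsE.
Qed.

Lemma constraint_mxE c p : atlas c -> dom c p ->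
  constraint_mx g v c p =
  (\matrix_i v i p) *m invmx (gram_mx g p) *m (\matrix_i v i p)^T.
Proof.
move=> ac cp; rewrite /constraint_mx omega_mxE -(metric_inv g ac cp).
by move: (frame_mx c p) => E; rewrite trmx_mul trmxK !mulmxA.
Qed.

Lemma constraint_unit c p : atlas c -> dom c p ->
  free [seq v i p | i : 'I_s] -> constraint_mx g v c p \in unitmx.
Proof.
move=> ac cp vfree; rewrite constraint_mxE//; apply/posdef_unit/posdef_gram.
  exact: cogram_posdef.
by rewrite -free_rows.
Qed.

Lemma metric_sym c p : (metric_mx g c p)^T = metric_mx g c p.
Proof. by apply/matrixP => A B; rewrite !mxE ip_sym. Qed.

Lemma constraint_sym c p : (constraint_mx g v c p)^T = constraint_mx g v c p.
Proof. by rewrite /constraint_mx !trmx_mul trmxK trmx_inv metric_sym mulmxA. Qed.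

(** The factors frame and coframe cancel, and turn the inverse Gram matrix in the
    preferred chart into the inverse metric matrix in c. *)
Lemma end_orth_proj c p (V : {vspace cotangent p}) : atlas c -> dom c p ->
  free [seq v i p | i : 'I_s] -> V = <<[seq v i p | i : 'I_s]>>%VS ->
  end_mx c (orth_proj g V) =
  1%:M - (omega_mx v c p)^T *m invmx (constraint_mx g v c p) *m omega_mx v c p
         *m invmx (metric_mx g c p).
Proof.
move=> ac cp vfree VE; apply: trmx_inj.
rewrite (end_mxE c (fun a => orth_projE g a vfree VE)) [RHS]linearB /= trmx1.
have EG := mul_frame_coframe ac cp.
rewrite 3!trmx_mul !trmx_inv metric_sym constraint_sym trmxK.
rewrite /coproj_mx -(constraint_mxE ac cp) -(metric_inv g ac cp) omega_mxE.
move: (frame_mx c p) (coframe_mx c p) EG => E G EG.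
move: (invmx (metric_mx g c p)) (invmx (constraint_mx g v c p)) => M K.
have GE : G^T *m E^T = 1%:M by rewrite -trmx_mul EG trmx1.
by rewrite mulmxBr mulmx1 mulmxBl GE trmx_mul trmxK !mulmxA GE mul1mx.
Qed.

End Coordinates.

(** * Ordering the generators *)

Section Reordering.
Variables (m s : nat) (le_sm : (s <= m)%N) (f : 'I_s -> 'I_m).

(** List the values of f first, then the remaining indices. *)
Lemma extend_injection : injective f ->
  exists2 h : 'I_m -> 'I_m, bijective h & forall i, h (widen_ord le_sm i) = f i.
Proof.
move=> finj; pose l := codom f ++ [seq j <- enum 'I_m | j \notin codom f].
have lu : uniq l.
  have cu : uniq (codom f) by exact/injectiveP.
  rewrite cat_uniq cu filter_uniq ?enum_uniq// andbT.
  by apply/hasPn => j; rewrite mem_filter => /andP[].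
have lm : l =i enum 'I_m.
  by move=> j; rewrite mem_cat mem_filter mem_enum andbT orbN.
have lsz : size l = m.
  by rewrite (perm_size (uniq_perm lu (enum_uniq _) lm)) size_enum_ord.
exists (fun i => nth i l i).
  apply: injF_bij => i j; rewrite (set_nth_default j) ?lsz// => /eqP.
  by rewrite nth_uniq ?lsz// => /eqP/val_inj.
move=> i; rewrite nth_cat size_codom card_ord /= ltn_ord.
by rewrite (nth_map i) ?size_enum_ord// nth_ord_enum.
Qed.

End Reordering.

Lemma free_subfamily (R : fieldType) (n m s : nat) (f : 'I_s -> 'I_m)
    (w : 'I_m -> 'rV[R]_n) : injective f ->
  free [seq w i | i : 'I_m] -> free [seq w (f i) | i : 'I_s].
Proof.
move=> finj wfree; have /injectiveP winj : uniq (codom w) by exact: free_uniq wfree.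
have wfu : uniq (codom (fun i => w (f i))) by apply/injectiveP => i j /winj /finj.
set X := [seq _ | i : 'I_s]; pose Y := [seq a <- codom w | a \notin X].
suff XY : perm_eq (codom w) (X ++ Y) by apply: (@catl_free _ _ Y); rewrite -(perm_free XY).
apply: uniq_perm; first exact: free_uniq wfree.
  rewrite cat_uniq wfu filter_uniq ?(free_uniq wfree)// andbT.
  by apply/hasPn => a; rewrite mem_filter => /andP[].
move=> a; rewrite mem_cat mem_filter; case: (boolP (a \in X)) => //= /codomP[i ->].
exact: codom_f.
Qed.

Section Generators.
Variables (R : realType) (n : nat) (Q : manifold R n) (D : codistribution Q).

Lemma generated_reindex W m (w : 'I_m -> one_form Q) (h : 'I_m -> 'I_m) :
  bijective h -> generated_on D W w -> generated_on D W (w \o h).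
Proof.
move=> [h' hK h'K] [oW wsm wD]; split=> // [i|p Wp]; first exact: wsm.
rewrite (wD p Wp); apply: eq_span => a; apply/idP/idP => /codomP[i ->].
  by rewrite -(h'K i); exact: (codom_f (fun i => w (h i) p)).
exact: (codom_f (fun i => w i p)).
Qed.

Lemma free_subspan W m (w : 'I_m -> one_form Q) s (f : 'I_s -> 'I_m) p :
  generated_on D W w -> W p ->
  (<<[seq w (f i) p | i : 'I_s]>> <= D p)%VS.
Proof.
move=> [_ _ wD] Wp; rewrite (wD p Wp); apply/span_subvP => a /codomP[i ->].
by apply: memv_span; exact: (codom_f (fun i => w i p)).
Qed.

End Generators.

Section Ordering.
Variables (R : realType) (n : nat) (Q : manifold R n) (D : codistribution Q).
Variables (q : R -> Q) (t0 : R) (r s : nat).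
Hypothesis qt0 : q @ t0^'+ --> q t0.
Hypothesis rank_after : \forall t \near t0^'+, rank_at D (q t) = s.

Lemma generated_near W m (w : 'I_m -> one_form Q) : generated_on D W w ->
  W (q t0) -> \forall t \near t0^'+, W (q t).
Proof. by move=> [oW _ _] W0; apply: qt0; exact: open_nbhs_nbhs. Qed.

(** A free family of s covectors in a space of dimension s spans it. *)
Lemma independent_span W m (w : 'I_m -> one_form Q) (f : 'I_s -> 'I_m) :
  generated_on D W w -> W (q t0) -> independent_after q t0 (w \o f) ->
  \forall t \near t0^'+, free [seq w (f i) (q t) | i : 'I_s] /\
                         D (q t) = <<[seq w (f i) (q t) | i : 'I_s]>>%VS.
Proof.
move=> wD W0 wfree; have Wn := generated_near wD W0.
apply: filterS3 Wn wfree rank_after => t Wt ft rt; split=> //.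
have := basisEfree [seq w (f i) (q t) | i : 'I_s] (D (q t)).
rewrite ft (free_subspan f wD Wt) size_codom card_ord -/(rank_at D (q t)) rt leqnn.
by move=> /span_basis.
Qed.

(** When r exceeds s, the chosen independent generators are moved to the front.
    Otherwise there are exactly s generators, and they span a space of dimension s. *)
Lemma exists_ordering :
  (exists (W : set Q) (w : 'I_(maxn s r) -> one_form Q),
     [/\ W (q t0), generated_on D W w &
         (s < r)%N -> exists f : 'I_s -> 'I_(maxn s r),
           independent_after q t0 (w \o f)]) ->
  exists (W : set Q) (w : 'I_(maxn s r) -> one_form Q),
        [/\ W (q t0), generated_on D W w & independent_after q t0 (first_forms w)].
Proof.
move=> [W [w [W0 wD wf]]]; exists W.
case: (boolP (s < r)%N) => [/wf [f ff]|]; last rewrite -leqNgt => le_rs.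
  have finj : injective f.
    have [t ft] : exists t, free [seq (w \o f) i (q t) | i : 'I_s].
      exact: (@filter_ex _ t0^'+ _ _ ff).
    have /injectiveP winj : uniq (codom (fun i => (w \o f) i (q t))) by exact: free_uniq ft.
    by move=> i j fij; apply: winj; rewrite /= fij.
  have [h hbij hf] := extend_injection (leq_maxl s r) finj.
  exists (w \o h); split=> //; first exact: generated_reindex.
  apply: filterS ff => t; rewrite /first_forms.
  by under [X in _ -> is_true (free X)]eq_map do rewrite /= hf.
exists w; split=> //; apply: filterS2 (generated_near wD W0) rank_after => t Wt rt.
have ms : maxn s r = s by apply/maxn_idPl.
have widen_inj : injective (widen_ord (leq_maxl s r)).
  by move=> i j /(congr1 val) /= ij; exact: val_inj.
apply: (free_subfamily (w := fun i => w i (q t)) widen_inj).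
have [_ _ wDt] := wD.
by rewrite /free -(wDt _ Wt) size_codom card_ord -/(rank_at D (q t)) rt ms.
Qed.

End Ordering.

(** * The coordinate formula after the crossing *)

Section Formula.
Variables (R : realType) (n : nat) (Q : manifold R n) (g : riemannian_metric Q).
Variables (D : codistribution Q) (q : R -> Q) (t0 : R) (s : nat).
Variables (v : 'I_s -> one_form Q).
Hypothesis qt0 : q @ t0^'+ --> q t0.
Hypothesis vbasis_after : \forall t \near t0^'+,
  free [seq v i (q t) | i : 'I_s] /\ D (q t) = <<[seq v i (q t) | i : 'I_s]>>%VS.

Lemma near_constraint_unit c : charts_around (q t0) c ->
  \forall t \near t0^'+, constraint_mx g v c (q t) \in unitmx.
Proof.
move=> hc; have [ac _] := hc.
apply: filterS2 (near_dom qt0 hc) vbasis_after => t ct [ft _].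
exact: constraint_unit.
Qed.

(** Near t0 on the right the matrix on the left is 1 minus that of the projector. *)
Lemma cvg_formula c (P : cotangent (q t0) -> cotangent (q t0)) :
  charts_around (q t0) c ->
  cotangent_end_cvg q t0^'+ t0 (fun t => orth_proj g (D (q t))) P ->
  (omega_mx v c (q t))^T *m invmx (constraint_mx g v c (q t)) *m omega_mx v c (q t)
     *m invmx (metric_mx g c (q t)) @[t --> t0^'+] --> 1%:M - end_mx c P.
Proof.
move=> hc /(_ c hc) hP; have [ac _] := hc.
apply: (cvg_eq_near _ _ (cvgB (cvg_cst (1%:M : 'M[R]_n)) hP)).
apply: filterS2 (near_dom qt0 hc) vbasis_after => t ct [ft Dt].
apply: etrans (congr1 (fun M => 1%:M - M) (end_orth_proj g ac ct ft Dt)) _.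
exact: subKr.
Qed.

End Formula.

Theorem mainTheorem1 (R : realType) (n : nat) (Q : manifold R n)
  (g : riemannian_metric Q) (U : Q -> R) (hU : smooth_fun U)
  (D : codistribution Q) (hD : differentiable_codistribution D)
  (q : R -> Q) (t0 eps : R) (r s : nat) (pm : cotangent (q t0))
  (hq : crossing g U D q t0 eps r s pm)
  (hs : (rank_at D (q t0) < s)%N)
  (hgen : exists (W : set Q) (w : 'I_(maxn s r) -> one_form Q),
     [/\ W (q t0), generated_on D W w &
         (s < r)%N -> exists f : 'I_s -> 'I_(maxn s r),
           independent_after q t0 (w \o f)])
  (Plim : {linear cotangent (q t0) -> cotangent (q t0)})
  (hlim : cotangent_end_cvg q t0^'+ t0 (fun t => orth_proj g (D (q t))) Plim) :
  [/\ exists (W : set Q) (w : 'I_(maxn s r) -> one_form Q),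
        [/\ W (q t0), generated_on D W w & independent_after q t0 (first_forms w)],
      forall pp : cotangent (q t0),
        jump_conditions g D q t0 eps pm pp <-> pp = Plim pm &
      forall (W : set Q) (w : 'I_(maxn s r) -> one_form Q),
        W (q t0) -> generated_on D W w -> independent_after q t0 (first_forms w) ->
        let v := first_forms w in
        ~~ free [seq v i (q t0) | i : 'I_s] /\
        forall c : chart R n Q, charts_around (q t0) c ->
          let omega t := omega_mx v c (q t) in
          let C t := constraint_mx g v c (q t) in
          let ginv t := invmx (metric_mx g c (q t)) in
          [/\ \forall t \near t0^'+, C t \in unitmx,
              forall A K : 'I_n,
                cvg ((\sum_(i < s) \sum_(j < s) \sum_(B < n)
                        invmx (C t) i j * omega t j B * ginv t B K * omega t i A)
                     @[t --> t0^'+]),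
              cvg ((omega t)^T *m invmx (C t) *m omega t *m ginv t @[t --> t0^'+]) &
              forall pp : cotangent (q t0), jump_conditions g D q t0 eps pm pp ->
                (forall A : 'I_n,
                   components c pp 0 A = components c pm 0 A -
                     \sum_(K < n)
                       lim ((\sum_(i < s) \sum_(j < s) \sum_(B < n)
                               invmx (C t) i j * omega t j B * ginv t B K * omega t i A)
                            @[t --> t0^'+]) * components c pm 0 K) /\
                (components c pp)^T =
                  (1%:M - lim ((omega t)^T *m invmx (C t) *m omega t *m ginv t
                               @[t --> t0^'+])) *m (components c pm)^T]].
Proof.
have eps_gt0 := crossing_eps hq.
have qt0 : q @ t0^'+ --> q t0.
  apply: cvg_within_filter; apply: (crossing_continuous hq).
  by rewrite in_itv /= ltrDl eps_gt0 gtrBl eps_gt0.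
have rank_after : \forall t \near t0^'+, rank_at D (q t) = s.
  by apply: filterS (near_after t0 eps_gt0) => t; exact: (crossing_rank_after hq).
have jumpP pp : jump_conditions g D q t0 eps pm pp <-> pp = Plim pm.
  exact: jump_iff.
split=> //; first exact: exists_ordering.
move=> W w W0 wD wind v.
have vbasis_after := independent_span qt0 rank_after wD W0 wind.
split.
  (* Their span lies in the fibre of D at q t0, of dimension less than s. *)
  apply/negP => /eqP; rewrite size_codom card_ord => dimv.
  have := dimvS (free_subspan (widen_ord (leq_maxl s r)) wD W0).
  by rewrite dimv leqNgt hs.
(* The local definitions are expanded to match the generic limits below. *)
move=> c hc; have [ac cp] := hc; cbv beta zeta.
have cvgL := cvg_formula (v := v) qt0 vbasis_after hc hlim.
have rightF : Filter t0^'+ by apply: _.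
have cvgS A K := @cvg_index_sum R R t0^'+ s n
  (fun t => invmx (constraint_mx g v c (q t))) (fun t => omega_mx v c (q t))
  (fun t => invmx (metric_mx g c (q t))) _ A K rightF cvgL.
split.
- exact: (near_constraint_unit g qt0 vbasis_after hc).
- by move=> A K; apply/cvg_ex; eexists; exact: cvgS.
- by apply/cvg_ex; eexists; exact: cvgL.
move=> pp /jumpP ->.
have Plin b : Plim b = b *m lin1_mx Plim by rewrite mul_rV_lin1.
have compE := components_end pm ac cp Plin.
move: (components c (Plim pm)) compE => y yE.
pose L := @end_mx R n Q c (q t0) Plim.
have yT : y^T = (1%:M - (1%:M - L)) *m (components c pm)^T.
  have -> : 1%:M - (1%:M - L) = L by exact: subKr.
  by rewrite yE trmx_mul trmxK.
have limS A K := cvg_lim (@norm_hausdorff _ R^o) (cvgS A K).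
split; last by rewrite (cvg_lim (@norm_hausdorff _ _) cvgL).
move=> A; rewrite (sub_mulmx_entry yT); congr (_ - _); apply: eq_bigr => K _.
by congr (_ * _); exact/esym/limS.
Qed.
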